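(* Let $A$ be a Noetherian $\mathbb K$-algebra, $U\subset R_A^m(-\mathbf d)$ a quasi-stable module and $M\subset R_A^m(-\mathbf d)$ a module generated by a $U$-marked basis $F$. Let $t>0$. If the matrix representing the homomorphism $\partial_t$ in the $U$-resolution of $M$ contains no non-zero constant entries (i.e. no entries that are non-zero elements of $A$), then the same holds for the matrix representing $\partial_{t+1}$.
   Context: $\mathbb K$ is a field, $R=\mathbb K[x_0,\dots,x_n]$ with the standard grading and $x_0<\dots<x_n$; $R_A=R\otimes_{\mathbb K}A=A[x_0,\dots,x_n]$. A term of $R$ is a monomial $x^\alpha$; for $x^\alpha\neq1$, $\min(x^\alpha)$ is the smallest variable dividing it. Variables $x_i>\min(x^\alpha)$ are non-multiplicative for $x^\alpha$ (the term $1$ has no non-multiplicative variables). For $\mathbf d\in\mathbb Z^m$, $R_A^m(-\mathbf d)=\bigoplus_k R_A(-d_k)\mathbf e_k$, with terms $x^\alpha\mathbf e_k$ of degree $|\alpha|+d_k$. A submodule is monomial if generated by terms; $\mathcal N(U)$ is the set of terms not in the monomial module $U$. Pommaret cone: $\mathcal C(x^\alpha)=\{x^\delta x^\alpha\mid\delta_i=0\ \forall x_i>\min(x^\alpha)\}$ for $x^\alpha\neq 1$, $\mathcal C(1)=$ all terms, $\mathcal C(x^\alpha\mathbf e_k)=\mathcal C(x^\alpha)\mathbf e_k$. A Pommaret basis of $U$ is a set of terms generating $U$ whose cones partition the set of terms of $U$; it is unique if it exists, denoted $\mathcal P_U$. $U$ is quasi-stable if it has a finite Pommaret basis, stable if moreover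 $\mathcal P_U$ is its minimal monomial generating set. A $U$-marked set is a finite set $F=\{f_{\alpha,k}\}_{x^\alpha\mathbf e_k\in\mathcal P_U}$ of homogeneous elements such that $x^\alpha\mathbf e_k$ has coefficient $1$ in $f_{\alpha,k}$ and the support of $f_{\alpha,k}-x^\alpha\mathbf e_k$ is contained in $\mathcal N(U)$. It is a $U$-marked basis if $(R_A^m(-\mathbf d))_s=(F)_s\oplus\langle\mathcal N(U)_s\rangle_A$ for all $s$. Then each $f\in(F)$ has a unique writing $f=\sum P_{\gamma,\ell}f_{\gamma,\ell}$ with $P_{\gamma,\ell}\in R_A$ and all terms of $P_{\gamma,\ell}x^\gamma$ in $\mathcal C(x^\gamma)$. $U$-resolution of $M=(F)$: let $P_0=\bigoplus_{x^\alpha\mathbf e_k\in\mathcal P_U}R_A(-\deg x^\alpha\mathbf e_k)\mathbf f_{\alpha,k}$ and $\partial_0(\mathbf f_{\alpha,k})=f_{\alpha,k}$. For $x_i>\min(x^\alpha)$ the fundamental syzygy is $S_{i,\alpha,k}=x_i\mathbf f_{\alpha,k}-\sum P_{\gamma,\ell}\mathbf f_{\gamma,\ell}$, where $x_if_{\alpha,k}=\sum P_{\gamma,\ell}f_{\gamma,\ell}$ is the unique writing. The set $F^{\partial_1}$ of all fundamental syzygies is a $U^{(1)}$-marked basis of $\ker\partial_0$ (head term of $S_{i,\alpha,k}$: $x_i\mathbf f_{\alpha,k}$), where $U^{(1)}$ is the stable module with Pommaret basis $\{x_i\mathbf f_{\alpha,k}\mid x_i>\min(x^\alpha)\}$. Iterating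 (known), $F^{\partial_t}$, the set of fundamental syzygies of $F^{\partial_{t-1}}$ (with $F^{\partial_0}=F$), is a marked basis of $\ker\partial_{t-1}$ over a stable module $U^{(t)}$; $\partial_t$ is the homomorphism from the graded free module $P_t$ with basis indexed by $F^{\partial_t}$ to $P_{t-1}$ whose matrix has the elements of $F^{\partial_t}$ as columns. The resulting finite graded free resolution $\cdots\to P_1\xrightarrow{\partial_1}P_0\xrightarrow{\partial_0}M\to0$ is the $U$-resolution of $M$. *)

(* Defs.v *)
From HB Require Import structures.
From mathcomp Require Import all_boot all_order all_algebra.
From mathcomp Require Import mpoly.
From Stdlib Require Import ClassicalEpsilon.

Set Implicit Arguments.
Unset Strict Implicit.
Unset Printing Implicit Defensive.

Import GRing.Theory.
Local Open Scope ring_scope.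

Definition is_ideal (A : comNzRingType) (I : A -> Prop) : Prop :=
  [/\ I 0, forall a b, I a -> I b -> I (a + b) & forall a b, I b -> I (a * b)].

Definition noetherian (A : comNzRingType) : Prop :=
  forall I : A -> Prop, is_ideal I ->
  exists (r : nat) (g : 'I_r -> A),
    forall a, I a <-> exists c : 'I_r -> A, a = \sum_(i < r) c i * g i.

Section Monomials.
Variable n : nat.

(* The smallest variable dividing x^al; None when x^al = 1. *)
Definition mnm_min (al : 'X_{1..n.+1}) : option 'I_n.+1 :=
  [pick i : 'I_n.+1 | (0 < al i)%N && [forall j : 'I_n.+1, (j < i)%N ==> (al j == 0%N)]].

Definition nonmult (al : 'X_{1..n.+1}) (i : 'I_n.+1) : bool :=
  if mnm_min al is Some k then (k < i)%N else false.

Definition in_cone (al be : 'X_{1..n.+1}) : Prop :=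
  exists de : 'X_{1..n.+1},
    be = (de + al)%MM /\ forall i, nonmult al i -> de i = 0%N.

(* (al, k) stands for the term x^al e_k of a free module with basis e_k, k < m. *)
Definition mterm (m : nat) : Type := ('X_{1..n.+1} * 'I_m)%type.

Definition term_cone (m : nat) (s t : mterm m) : Prop :=
  t.2 = s.2 /\ in_cone s.1 t.1.

Definition tdeg (m : nat) (d : 'I_m -> int) (t : mterm m) : int :=
  (mdeg t.1)%:Z + d t.2.

End Monomials.

Section FreeModules.
Variables (n : nat) (A : comNzRingType).
Local Notation RA := {mpoly A[n.+1]}.

(* Elements of R_A^m are column vectors; submodules are predicates on them. *)
Definition tvec (m : nat) (t : mterm n m) : 'cV[RA]_m :=
  'X_[t.1] *: delta_mx t.2 0.

Definition in_supp (m : nat) (v : 'cV[RA]_m) (t : mterm n m) : Prop :=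
  (v t.2 0)@_(t.1) <> 0.

Definition homog_of (m : nat) (d : 'I_m -> int) (s : int) (v : 'cV[RA]_m) : Prop :=
  forall t, in_supp v t -> tdeg d t = s.

Definition generated_by_terms (m : nat) (T : mterm n m -> Prop)
    (U : 'cV[RA]_m -> Prop) : Prop :=
  forall v, U v <->
    exists (r : nat) (t : 'I_r -> mterm n m) (c : 'I_r -> RA),
      (forall i, T (t i)) /\ v = \sum_(i < r) c i *: tvec (t i).

Definition monomial_module (m : nat) (U : 'cV[RA]_m -> Prop) : Prop :=
  exists T, generated_by_terms T U.

(* H enumerates the basis; the second clause says that the terms of U are
   exactly those lying in some cone, and that the cones are disjoint. It also
   forces H to be injective, as every term lies in its own cone. *)
Definition pommaret_basis (m N : nat) (U : 'cV[RA]_m -> Prop)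
    (H : 'I_N -> mterm n m) : Prop :=
  generated_by_terms (fun t => exists j, t = H j) U /\
  forall t, (U (tvec t) <-> exists j, term_cone (H j) t) /\
    forall j j', term_cone (H j) t -> term_cone (H j') t -> j = j'.

Definition quasi_stable (m : nat) (U : 'cV[RA]_m -> Prop) : Prop :=
  monomial_module U /\ exists (N : nat) (H : 'I_N -> mterm n m), pommaret_basis U H.

Definition span_cols (m N : nat) (F : 'M[RA]_(m, N)) (v : 'cV[RA]_m) : Prop :=
  exists c : 'cV[RA]_N, v = F *m c.

(* The columns of F are the marked elements; column j has head term H j. *)
Definition marked_set (m N : nat) (d : 'I_m -> int) (U : 'cV[RA]_m -> Prop)
    (H : 'I_N -> mterm n m) (F : 'M[RA]_(m, N)) : Prop :=
  pommaret_basis U H /\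
  forall j, [/\ exists s, homog_of d s (col j F),
    (F (H j).2 j)@_((H j).1) = 1
    & forall t, in_supp (col j F - tvec (H j)) t -> ~ U (tvec t)].

(* An element of the A-span of the terms of degree s outside U. *)
Definition in_normal_span (m : nat) (d : 'I_m -> int) (U : 'cV[RA]_m -> Prop)
    (s : int) (v : 'cV[RA]_m) : Prop :=
  forall t, in_supp v t -> ~ U (tvec t) /\ tdeg d t = s.

Definition marked_basis (m N : nat) (d : 'I_m -> int) (U : 'cV[RA]_m -> Prop)
    (H : 'I_N -> mterm n m) (F : 'M[RA]_(m, N)) : Prop :=
  marked_set d U H F /\
  forall s : int,
    (forall v, homog_of d s v ->
       exists f h, [/\ span_cols F f, homog_of d s f,
                       in_normal_span d U s h & v = f + h]) /\
    (forall v, span_cols F v -> homog_of d s v -> in_normal_span d U s v -> v = 0).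

(* v = \sum_j P_j f_j with all terms of P_j * (head of f_j) in the cone of the
   head of f_j. *)
Definition is_writing (m N : nat) (H : 'I_N -> mterm n m) (F : 'M[RA]_(m, N))
    (v : 'cV[RA]_m) (P : 'cV[RA]_N) : Prop :=
  v = F *m P /\
  forall j de, in_supp P (de, j) -> in_cone (H j).1 (de + (H j).1)%MM.

(* Meaningful when v has a writing, as is the case for the elements of the
   module generated by a marked basis, where moreover it is unique. *)
Definition writing (m N : nat) (H : 'I_N -> mterm n m) (F : 'M[RA]_(m, N))
    (v : 'cV[RA]_m) : 'cV[RA]_N :=
  epsilon (inhabits 0) (is_writing H F v).

Definition fund_syz (m N : nat) (H : 'I_N -> mterm n m) (F : 'M[RA]_(m, N))
    (p : 'I_N * 'I_n.+1) : 'cV[RA]_N :=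
  'X_(p.2) *: delta_mx p.1 0 - writing H F ('X_(p.2) *: col p.1 F).

(* mf_mx is the matrix of the homomorphism from the free module on the marked
   elements to the graded free module of rank mf_rk with shifts mf_sh. *)
Record marked_family : Type := MarkedFamily {
  mf_rk : nat;
  mf_size : nat;
  mf_sh : 'I_mf_rk -> int;
  mf_head : 'I_mf_size -> mterm n mf_rk;
  mf_mx : 'M[RA]_(mf_rk, mf_size)
}.

Definition nonmult_pairs (D : marked_family) : {set 'I_(mf_size D) * 'I_n.+1} :=
  [set p | nonmult (mf_head p.1).1 p.2].

Definition syz_family (D : marked_family) : marked_family :=
  @MarkedFamily (mf_size D) #|nonmult_pairs D|
    (fun j => tdeg (@mf_sh D) (mf_head j))
    (fun q => let p := enum_val q in (U_(p.2)%MM, p.1))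
    (\matrix_(j, q) fund_syz (@mf_head D) (mf_mx D) (enum_val q) j 0).

Fixpoint Uresolution (D : marked_family) (t : nat) : marked_family :=
  if t is s.+1 then syz_family (Uresolution D s) else D.

Definition differential (D : marked_family) (t : nat) := mf_mx (Uresolution D t).

Definition no_nonzero_constant (p q : nat) (B : 'M[RA]_(p, q)) : Prop :=
  forall i j (c : A), B i j = c%:MP -> c = 0.

End FreeModules.

(* Main.v *)
Require Import Defs.
From HB Require Import structures.
From mathcomp Require Import all_boot all_order all_algebra.
From mathcomp Require Import ssrcomplements mpoly zify.
From Stdlib Require Import Classical ClassicalEpsilon.

Set Implicit Arguments.
Unset Strict Implicit.
Unset Printing Implicit Defensive.

Import Order.TTheory GRing.Theory.
Local Open Scope ring_scope.

(** The heart of the matter is a comparison of one coefficient.  For t > 0 the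
    head terms of the columns f_j of the matrix of the t-th differential are
    terms x_a e_b of degree one.  If x_i is non-multiplicative for the head of
    f_j, the corresponding column of the next matrix is
    x_i e_j - P, where x_i f_j = sum_l P_l f_l is the involutive writing, so a
    constant entry is a constant term of some P_l.  Let x_a e_b be the head of
    f_l and compare the coefficients of x_a e_b in the writing.  The entries of
    the matrix are homogeneous, so if none of them is a non-zero constant then
    none has a constant term.  Hence x_i f_j has no term of degree one in any
    component, and on the right only the constant terms of the P_l' contribute,
    multiplied by the coefficients of x_a e_b in the f_l'.  By the definition of
    a marked family this coefficient is 1 for l' = l and 0 for l' <> l, so the
    constant term of P_l is 0 ([syz_no_constant]).

    This presupposes that the writings exist and that all the matrices of the
    resolution are homogeneous marked families, that is, the part of the theory
    of U-resolutions that says that fundamental syzygies form a marked basis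
    again.  It rests on a descent for the lexicographic order that looks at the
    largest variable first ([cone_descent]): if a term x^de x^ep with x^ep
    outside U lies in the cone of a head x^al, then the multiplier of x^al is
    smaller than x^de.  Replacing covered terms by tails thus makes multipliers
    decrease.
    Since the order is a well-order, every vector is F P + h with P involutive
    and h without terms in U ([reducible_all]); looking at a maximal multiplier,
    F P has no term in U only if P = 0 ([conical_normal_eq0]).  Uniqueness of
    writings makes them homogeneous.

    The passage to syzygies is then short because of a duality: the terms
    allowed in an involutive writing for F are exactly the terms outside the
    module generated by the heads of the fundamental syzygies
    ([conical_syz_normal]).  So fundamental syzygies have normal tails, and the
    normal remainder h of a syzygy modulo the fundamental ones is itself an
    involutive writing of F h = 0, so that it vanishes. *)

Lemma exists_max_key disp (T : orderType disp) (I : eqType) (key : I -> T)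
    (s : seq I) x0 : x0 \in s ->
  exists2 x, x \in s & forall y, y \in s -> (key y <= key x)%O.
Proof.
move=> /(tnthP (in_tuple s))[i0 _].
have [i _ max_i] := @arg_maxP _ _ _ i0 xpredT (key \o tnth (in_tuple s)) isT.
exists (tnth (in_tuple s) i) => [|y /(tnthP (in_tuple s))[j ->]].
  exact: mem_tnth.
exact: max_i.
Qed.

(** * Pommaret cones and the descent of multipliers *)

Section Monomials.
Variable n : nat.
Implicit Types (al be de ep : 'X_{1..n.+1}) (i k : 'I_n.+1).

Lemma nonmultP al i :
  reflect (exists2 k : 'I_n.+1, (k < i)%N & (0 < al k)%N) (nonmult al i).
Proof.
rewrite /nonmult /mnm_min; case: pickP => [k /andP[al_k /forallP k_min]|no_min].
  apply: (iffP idP) => [lt_ki|[j lt_ji al_j]]; first by exists k.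
  apply: leq_ltn_trans lt_ji; rewrite leqNgt; apply/negP => lt_jk.
  by move: (k_min j); rewrite lt_jk /= -leqn0 leqNgt al_j.
apply: (iffP idP) => // -[j lt_ji al_j].
have [k al_k k_min] := @arg_minnP _ j (fun l => 0 < al l)%N (@nat_of_ord _) al_j.
have /negP[] := no_min k; rewrite al_k; apply/forallP => l; apply/implyP => lt_lk.
by rewrite -leqn0 leqNgt; apply/negP => /k_min; rewrite leqNgt lt_lk.
Qed.

Lemma nonmult_trans al i k : nonmult al i -> (i < k)%N -> nonmult al k.
Proof.
move=> /nonmultP[l lt_li al_l] lt_ik; apply/nonmultP.
by exists l => //; apply: ltn_trans lt_ik.
Qed.

Lemma nonmult_var i k : nonmult U_(i)%MM k = (i < k)%N.
Proof.
apply/nonmultP/idP => [[l lt_lk]|lt_ik]; last by exists i; rewrite // mnm1E eqxx.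
by rewrite mnm1E; case: eqP => // ->.
Qed.

(** The largest variable of a term in the cone of a variable is that variable;
    this is why the cones of the heads of the fundamental syzygies are
    disjoint. *)
Lemma cone_var_inj i k (de ep : 'X_{1..n.+1}) :
    (forall l, nonmult U_(i)%MM l -> de l = 0%N) ->
    (forall l, nonmult U_(k)%MM l -> ep l = 0%N) ->
  (de + U_(i) = ep + U_(k))%MM -> i = k.
Proof.
wlog lt_ik : i k de ep / (i < k)%N => [wlog_lt mult_de mult_ep eq_t|mult_de _].
  case: (ltngtP i k) => [lt_ik|lt_ki|/ord_inj//]; first exact: wlog_lt eq_t.
  by apply/esym/(wlog_lt _ _ ep de).
move=> /mnmP/(_ k); rewrite !mnmDE !mnm1E eqxx mult_de ?nonmult_var //.
by case: eqP lt_ik => [->|_ _]; rewrite ?ltnn // addn1.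
Qed.

Lemma in_cone_mul al de :
  in_cone al (de + al)%MM <-> (forall i, nonmult al i -> de i = 0%N).
Proof.
by split=> [[de' [/addIm <-]]|mult_de] //; exists de.
Qed.

Lemma in_cone_refl al : in_cone al al.
Proof. by rewrite -[X in in_cone _ X]add0m in_cone_mul => i _; rewrite mnm0E. Qed.

(** The exponents are reversed so that the lexicographic comparison of tuples
    starts with the largest variable. *)
Definition colex al : (n.+1).-tuplelexi nat := [tuple al (rev_ord i) | i < n.+1].

Lemma colex_ltP al be :
  reflect (exists2 i : 'I_n.+1, (al i < be i)%N
             & forall k : 'I_n.+1, (i < k)%N -> al k = be k)
          (colex al < colex be)%O.
Proof.
apply: (iffP ltxi_tuplePlt) => [[i eq_lt]|[i lt_i eq_gt]].
  rewrite !tnth_mktuple ltEnat /= => lt_i; exists (rev_ord i) => // k lt_ik.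
  have := eq_lt (rev_ord k); rewrite !tnth_mktuple rev_ordK; apply.
  by move: lt_ik => /=; have := ltn_ord i; have := ltn_ord k; rewrite !subSS; lia.
exists (rev_ord i) => [k lt_k|]; rewrite !tnth_mktuple ?rev_ordK ?ltEnat //.
apply: eq_gt; move: lt_k => /=.
by have := ltn_ord i; have := ltn_ord k; rewrite !subSS; lia.
Qed.

Lemma colex_inj : injective colex.
Proof.
move=> al be eq_ab; apply/mnmP => i.
have := congr1 (fun t : (n.+1).-tuple nat => tnth t (rev_ord i)) eq_ab.
by rewrite !tnth_mktuple rev_ordK.
Qed.

Lemma colex_ind (P : 'X_{1..n.+1} -> Prop) :
  (forall al, (forall be, (colex be < colex al)%O -> P be) -> P al) ->
  forall al, P al.
Proof.
move=> ih al; move: {2}(colex al) (erefl (colex al)) => c.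
elim/(@ltxwf _ nat): c al => [Q IH x|c IH al c_al].
  by elim/ltn_ind: x => x IHx; apply: IH => y; rewrite ltEnat; apply: IHx.
by apply: ih => be lt_ba; apply: (IH (colex be)) => //; rewrite -c_al.
Qed.

(** At the largest variable x_i in which de and de' differ, suppose that de'
    has the larger exponent.  Then x_i is multiplicative for al, so al has no
    variable below x_i, while from x_i upwards ep has at least the exponents of
    al: thus al divides ep. *)
Lemma cone_descent al de de' ep :
    ~~ (al <= ep)%MM -> (forall i, nonmult al i -> de' i = 0%N) ->
    (de + ep = de' + al)%MM -> (colex de' < colex de)%O.
Proof.
move=> al_ep mult_de' /mnmP eq_t; case: ltgtP => //.
  move=> /colex_ltP[i lt_i eq_gt]; case/negP: al_ep; apply/mnm_lepP => k.
  have := eq_t k; rewrite !mnmDE => eq_k.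
  case: (ltngtP k i) => [lt_ki|lt_ik|/ord_inj eq_ki].
  - case: (posnP (al k)) => [-> //|al_k].
    have := mult_de' i; case: nonmultP => [_ /(_ isT)|[]]; last by exists k.
    by move=> de'0; rewrite de'0 in lt_i.
  - by have := eq_gt k lt_ik; lia.
  - by move: lt_i; rewrite -eq_ki; lia.
move=> /colex_inj eq_de; case/negP: al_ep; apply/mnm_lepP => k.
by have := eq_t k; rewrite !mnmDE eq_de; lia.
Qed.

End Monomials.

(** * Coefficients and homogeneous components *)

Section Coefficients.
Variables (n : nat) (A : comNzRingType).
Local Notation RA := {mpoly A[n.+1]}.

Lemma mcoeffM_neq0 (p q : RA) t : (p * q)@_t != 0 ->
  exists a b, [/\ t = (a + b)%MM, p@_a != 0 & q@_b != 0].
Proof.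
rewrite mcoeffM => nz; have [[a b] /andP[/= /eqP t_ab nz_ab]] :
    exists k : 'X_{1..n.+1 < (mdeg t).+1, (mdeg t).+1},
      (t == k.1 + k.2)%MM && (p@_k.1 * q@_k.2 != 0).
  apply/existsP; apply: contraR nz; rewrite negb_exists => /forallP all0.
  apply/eqP/big1 => k t_k; have := all0 k; rewrite t_k negbK => /eqP; exact.
exists a, b; split=> //; apply: contraNneq nz_ab => ->; rewrite ?mul0r ?mulr0 //.
Qed.

Lemma mcoeffM_single (p q : RA) t a b : t = (a + b)%MM ->
    (forall a' b', t = (a' + b')%MM -> p@_a' != 0 -> q@_b' != 0 -> b' = b) ->
  (p * q)@_t = p@_a * q@_b.
Proof.
move=> t_ab single; pose q' := q - q@_b *: 'X_[b].
have q'E c : q'@_c = q@_c *+ (c != b).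
  rewrite mcoeffB mcoeffZ mcoeffX eq_sym.
  by case: eqP => [->|_]; rewrite ?mulr1 ?mulr0 ?subrr ?subr0.
have q_split : q = q' + q@_b *: 'X_[b] by rewrite subrK.
rewrite {1}q_split mulrDr mcoeffD -scalerAr mcoeffZ.
rewrite [(p * 'X_[b])@_t](_ : _ = p@_a); last by rewrite t_ab addmC mcoeffMX.
rewrite [_ * p@_a]mulrC [X in X + _](_ : _ = 0) ?add0r //.
apply/eqP/negPn/negP.
move=> /mcoeffM_neq0[a' [b' [t_ab' p_a']]]; rewrite q'E.
have [//|ne_b] := eqVneq b' b; first by rewrite mulr0n eqxx.
by rewrite mulr1n => q_b'; rewrite (single _ _ t_ab' p_a' q_b') eqxx in ne_b.
Qed.

Lemma mcoeff_tvec m (t : mterm n m) k e :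
  (tvec A t k 0)@_e = ((e, k) == t)%:R.
Proof.
case: t => e' k'; rewrite /tvec !mxE eqxx andbT xpair_eqE /=.
case: eqP => [_|_]; first by rewrite mulr1 mcoeffX andbT eq_sym.
by rewrite mulr0 mcoeff0 andbF.
Qed.

Lemma scale_tvec m de (t : mterm n m) :
  'X_[de] *: tvec A t = tvec A ((de + t.1)%MM, t.2).
Proof. by rewrite /tvec scalerA mpolyXD. Qed.

Lemma tvec_sum m (v : 'cV[RA]_m) :
  v = \sum_k \sum_(e <- msupp (v k 0)) ((v k 0)@_e)%:MP *: tvec A (e, k).
Proof.
apply/matrixP => k j; rewrite ord1 {j} summxE (bigD1 k) //= [X in _ + X]big1 => [|l ne_lk].
  rewrite addr0 summxE [LHS]mpolyE; apply: eq_bigr => e _.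
  by rewrite !mxE !eqxx mulr1 mul_mpolyC.
rewrite summxE big1 // => e _; rewrite !mxE eq_sym (negPf ne_lk) /=.
by rewrite !mulr0.
Qed.

Lemma mulmx_scale_delta m N (F : 'M[RA]_(m, N)) (p : RA) j :
  F *m (p *: delta_mx j 0) = p *: col j F :> 'cV_m.
Proof. by rewrite -scalemxAr -colE. Qed.

(** The component of v of degree s when the k-th basis vector has degree d k. *)
Definition hpart m (d : 'I_m -> int) (s : int) (v : 'cV[RA]_m) : 'cV[RA]_m :=
  \col_k \sum_(e <- msupp (v k 0) | tdeg d (e, k) == s) (v k 0)@_e *: 'X_[e].

Lemma mcoeff_hpart m (d : 'I_m -> int) s v k e :
  (hpart d s v k 0)@_e = (v k 0)@_e *+ (tdeg d (e, k) == s).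
Proof.
rewrite mxE raddf_sum /=.
under eq_bigr => e' _ do rewrite mcoeffZ mcoeffX.
have [e_v|e_v] := boolP (e \in msupp (v k 0)); last first.
  rewrite (eqP (_ : (v k 0)@_e == 0)) ?mcoeff_eq0 // mul0rn big_seq_cond big1 //.
  move=> e' /andP[e'_v _]; case: eqP => [e_e'|]; last by rewrite mulr0.
  by rewrite -e_e' e'_v in e_v.
rewrite big_mkcond (bigD1_seq e) ?msupp_uniq //= eqxx mulr1 big1 => [|e' ne_e'].
  by rewrite addr0; case: ifP.
by rewrite (negPf ne_e') mulr0 if_same.
Qed.

Lemma hpart_homog m (d : 'I_m -> int) s v : homog_of d s (hpart d s v).
Proof.
move=> [e k]; rewrite /in_supp mcoeff_hpart /=.
by case: eqP => // _ []; rewrite mulr0n.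
Qed.

Lemma hpart_id m (d : 'I_m -> int) s v : homog_of d s v -> hpart d s v = v.
Proof.
move=> hv; apply/matrixP => k j; rewrite ord1 {j}; apply/mpolyP => e.
rewrite mcoeff_hpart; have [->|/eqP v_e] := eqVneq ((v k 0)@_e) 0.
  by rewrite mul0rn.
by rewrite (hv (e, k) v_e) eqxx.
Qed.

Lemma hpart_eq0 m (d : 'I_m -> int) (v : 'cV[RA]_m) :
  (forall s, hpart d s v = 0) -> v = 0.
Proof.
move=> v0; apply/matrixP => k j; rewrite ord1 {j}; apply/mpolyP => e.
have := mcoeff_hpart d (tdeg d (e, k)) v k e.
by rewrite v0 eqxx mulr1n => <-.
Qed.

Lemma hpart_mulmx m N (d : 'I_m -> int) (d' : 'I_N -> int) (F : 'M[RA]_(m, N)) :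
    (forall j, homog_of d (d' j) (col j F)) ->
  forall s P, hpart d s (F *m P) = F *m hpart d' s P.
Proof.
move=> hF s P; apply/matrixP => k j; rewrite ord1 {j}; apply/mpolyP => e.
rewrite mcoeff_hpart !mxE !raddf_sum /= -sumrMnl; apply: eq_bigr => j _.
rewrite !mcoeffM -sumrMnl; apply: eq_bigr => -[a b] /eqP /= e_ab.
rewrite mcoeff_hpart mulrnAr; have [->|/eqP F_a] := eqVneq ((F k j)@_a) 0.
  by rewrite !mul0r !mul0rn.
have := hF j (bmnm a, k); rewrite /in_supp mxE => /(_ F_a) d'_j.
congr (_ *+ (_ == s)); rewrite /tdeg /= -d'_j /tdeg /=.
have : mdeg e = (mdeg a + mdeg b)%N by rewrite -mdegD -e_ab.
move: (mdeg a) (mdeg b) => x y ->.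
by rewrite PoszD -addrA addrCA.
Qed.

End Coefficients.

(** * Marked families and involutive writings *)

Section InvolutiveFamilies.
Variables (n : nat) (A : comNzRingType).
Local Notation RA := {mpoly A[n.+1]}.

(** The terms of the module U generated by the heads, when the heads form a
    Pommaret basis. *)
Definition covered (D : marked_family n A) (t : mterm n (mf_rk D)) : Prop :=
  exists j, term_cone (@mf_head _ _ D j) t.

(** The vectors supported in N(U). *)
Definition normal (D : marked_family n A) (v : 'cV[RA]_(mf_rk D)) : Prop :=
  forall t, covered t -> (v t.2 0)@_t.1 = 0.

(** The condition on the coefficients in an involutive writing. *)
Definition conical (D : marked_family n A) (P : 'cV[RA]_(mf_size D)) : Prop :=
  forall j de, in_supp P (de, j) ->
    in_cone (@mf_head _ _ D j).1 (de + (@mf_head _ _ D j).1)%MM.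

(** A marked set whose columns have the degrees of their heads, with the
    module U replaced by the set of terms covered by the cones of the heads.
    All steps of the resolution share this form. *)
Record premarked (D : marked_family n A) : Prop := {
  cone_disjoint : forall t j j', term_cone (@mf_head _ _ D j) t ->
    term_cone (@mf_head _ _ D j') t -> j = j';
  covered_mul : forall t de, @covered D t -> @covered D ((de + t.1)%MM, t.2);
  head_coef : forall j,
    (mf_mx D (@mf_head _ _ D j).2 j)@_((@mf_head _ _ D j).1) = 1;
  tail_normal : forall j t, @covered D t -> t <> @mf_head _ _ D j ->
    (mf_mx D t.2 j)@_t.1 = 0;
  col_homog : forall j,
    homog_of (@mf_sh _ _ D) (tdeg (@mf_sh _ _ D) (@mf_head _ _ D j))
      (col j (mf_mx D))
}.

(** For a premarked family this is what makes a marked set a marked basis. *)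
Definition has_writings (D : marked_family n A) : Prop :=
  forall c, exists P, is_writing (@mf_head _ _ D) (mf_mx D) (mf_mx D *m c) P.

Section Premarked.
Variable D : marked_family n A.
Hypothesis hD : premarked D.
Local Notation H := (@mf_head _ _ D).
Local Notation F := (mf_mx D).

Lemma head_covered j : @covered D (H j).
Proof. by exists j; split=> //; apply: in_cone_refl. Qed.

(** A covered multiple of a tail term has a smaller multiplier: the tail term is
    not covered, so no head divides it. *)
Lemma tail_descent j j' k (de de' ep : 'X_{1..n.+1}) :
    (F k j)@_ep != 0 -> (ep, k) <> H j -> k = (H j').2 ->
    (forall i, nonmult (H j').1 i -> de' i = 0%N) ->
    (de + ep = de' + (H j').1)%MM ->
  (colex de' < colex de)%O.
Proof.
move=> F_ep ne_head k_j' mult_de'; apply: cone_descent => //.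
apply/negP => le_ep; move/eqP: F_ep; apply.
apply: (tail_normal hD (t := (ep, k))) => //.
rewrite -(submK le_ep) k_j'.
exact: (covered_mul hD (ep - (H j').1)%MM (head_covered j')).
Qed.

(** Take a term of P with maximal multiplier de, in component j.  The term
    de * head j of F P cannot be cancelled: by descent a tail producing it would
    have a larger multiplier, and by disjointness of the cones no other head
    produces it. *)
Lemma conical_normal_eq0 P : conical P -> normal (F *m P) -> P = 0.
Proof.
move=> conP normP; apply/matrixP => j0 z; rewrite ord1 mxE {z}.
apply/mpolyP => de0; rewrite mcoeff0; apply/eqP/negPn/negP => P_de0.
pose supp := [seq (e, j) | j <- enum 'I_(mf_size D), e <- msupp (P j 0)].
have in_suppP e j : ((e, j) \in supp) = ((P j 0)@_e != 0).
  rewrite -mcoeff_msupp; apply/allpairsPdep/idP => [[j' [e' [_ ? [-> ->]]]]//|?].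
  by exists j, e; rewrite mem_enum.
have [[de j] P_de max_de] : exists2 x, x \in supp &
    forall y, y \in supp -> (colex y.1 <= colex x.1)%O.
  have supp0 : (de0, j0) \in supp by rewrite in_suppP.
  exact: (exists_max_key (fun x => colex x.1) supp0).
rewrite in_suppP in P_de.
have mult_de : forall i, nonmult (H j).1 i -> de i = 0%N.
  by apply/in_cone_mul/conP/eqP.
pose t : mterm n (mf_rk D) := ((de + (H j).1)%MM, (H j).2).
have t_j : term_cone (H j) t by split=> //; apply/in_cone_mul.
(* A contribution to the coefficient of t comes from the head of column j. *)
have only_head j' a b : t.1 = (a + b)%MM -> (F t.2 j')@_a != 0 ->
    (P j' 0)@_b != 0 -> j' = j /\ b = de.
  move=> t_ab F_a P_b.
  have [a_head|ne_head] := classic ((a, t.2) = H j').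
    have t_j' : term_cone (H j') t.
      split; first by rewrite -a_head.
      rewrite t_ab addmC (congr1 fst a_head : a = _).
      exact/conP/eqP.
    have eq_j := cone_disjoint hD t_j' t_j; split=> //.
    move: t_ab; rewrite addmC (congr1 fst a_head : a = _) eq_j /=.
    by move/addIm.
  have lt_de : (colex de < colex b)%O.
    apply: (tail_descent F_a ne_head (erefl : t.2 = (H j).2) mult_de).
    by rewrite addmC -t_ab.
  by move: lt_de; rewrite ltNge (max_de (b, j')) // in_suppP.
have := normP t (ex_intro _ j t_j).
rewrite mxE raddf_sum /= (bigD1 j) //= big1 => [|j' ne_j].
  rewrite addr0 (@mcoeffM_single _ _ _ _ _ (H j).1 de).
  - by rewrite (head_coef hD) mul1r; apply/eqP.
  - by rewrite addmC.
  - by move=> a b t_ab F_a P_b; have [] := only_head j a b t_ab F_a P_b.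
apply/eqP/negPn/negP => /mcoeffM_neq0[a [b [t_ab F_a P_b]]].
by have [eq_j _] := only_head _ _ _ t_ab F_a P_b; rewrite eq_j eqxx in ne_j.
Qed.

(** The normal form procedure terminates on v. *)
Definition reducible (v : 'cV[RA]_(mf_rk D)) : Prop :=
  exists P h, [/\ @conical D P, @normal D h & v = F *m P + h].

Lemma reducible0 : reducible 0.
Proof.
exists 0, 0; split; last by rewrite mulmx0 addr0.
  by move=> j de; rewrite /in_supp mxE mcoeff0.
by move=> t _; rewrite mxE mcoeff0.
Qed.

Lemma reducible_axpy (c : A) u v :
  reducible u -> reducible v -> reducible (c%:MP *: u + v).
Proof.
move=> [P [h [conP norm_h ->]]] [Q [g [conQ norm_g ->]]].
exists (c%:MP *: P + Q), (c%:MP *: h + g); split.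
- move=> j de; rewrite /in_supp !mxE mcoeffD mcoeffCM /= => nz.
  have [Q_de|Q_de] := eqVneq ((Q j 0)@_de) 0; last by apply/conQ/eqP.
  by apply: conP => P_de; apply: nz; rewrite P_de Q_de mulr0 addr0.
- move=> t t_D; rewrite !mxE mcoeffD mcoeffCM norm_h // norm_g //.
  by rewrite mulr0 addr0.
- by rewrite mulmxDr -scalemxAr scalerDr addrACA.
Qed.

Lemma reducible_terms v :
  (forall t, in_supp v t -> reducible (tvec A t)) -> reducible v.
Proof.
move=> red_v; rewrite [v]tvec_sum.
have red_add u w : reducible u -> reducible w -> reducible (u + w).
  by move=> /(reducible_axpy 1); rewrite mpolyC1 scale1r; apply.
apply: (big_ind _ reducible0 red_add) => k _.
rewrite big_seq; apply: (big_ind _ reducible0 red_add) => e e_v.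
rewrite -[_ *: _]addr0; apply: reducible_axpy reducible0.
by apply/red_v/eqP; rewrite /= -mcoeff_msupp.
Qed.

Lemma reducible_uncovered t : ~ @covered D t -> reducible (tvec A t).
Proof.
move=> t_D; exists 0, (tvec A t); split; last by rewrite mulmx0 add0r.
  by move=> j de; rewrite /in_supp mxE mcoeff0.
move=> u u_D; rewrite mcoeff_tvec -surjective_pairing.
by case: eqP => // eq_u; rewrite eq_u in u_D.
Qed.

Lemma mcoeff_tail j k e :
  ((col j F - tvec A (H j)) k 0)@_e = (F k j)@_e - ((e, k) == H j)%:R.
Proof.
by rewrite mxE mcoeffD [col j F k 0]mxE [(- tvec _ _) k 0]mxE mcoeffN
  mcoeff_tvec.
Qed.

(** Subtracting x^de f_j leaves terms x^de x^ep with x^ep in the tail of f_j.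
    They are normal or have a smaller multiplier, so well-founded induction on
    the multiplier applies. *)
Lemma reducible_cone (de : 'X_{1..n.+1}) j :
    (forall i, nonmult (H j).1 i -> de i = 0%N) ->
  reducible (tvec A ((de + (H j).1)%MM, (H j).2)).
Proof.
elim/colex_ind: de j => de IH j mult_de.
have -> : tvec A ((de + (H j).1)%MM, (H j).2) =
    (- 1)%:MP *: ('X_[de] *: (col j F - tvec A (H j))) + 'X_[de] *: col j F.
  by rewrite -scale_tvec scalerBr mpolyCN mpolyC1 scaleN1r opprB subrK.
apply: reducible_axpy; last first.
  exists ('X_[de] *: delta_mx j 0), 0; split.
  - move=> l e; rewrite /in_supp -[_ *: _]/(tvec A (de, j)) mcoeff_tvec /=.
    by case: eqP => // -[-> ->] _; apply/in_cone_mul.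
  - by move=> u _; rewrite mxE mcoeff0.
  - by rewrite mulmx_scale_delta addr0.
apply: reducible_terms => -[e k]; rewrite /in_supp mxE => /eqP.
move=> /mcoeffM_neq0[a [b [/= -> ]]]; rewrite mcoeffX.
case: (de =P a) => [<- _|_]; last by rewrite eqxx.
rewrite mcoeff_tail; case: ((b, k) =P H j) => [b_k|ne_head].
  by have := head_coef hD j; rewrite -b_k /= => ->; rewrite subrr eqxx.
rewrite subr0 => F_b.
have [[j' [/= k_j' [de' [e_de' mult_de']]]]|] :=
  classic (@covered D ((de + b)%MM, k)); last exact: reducible_uncovered.
rewrite e_de' k_j'; apply: (IH de' _ j' mult_de').
exact: tail_descent F_b ne_head k_j' mult_de' e_de'.
Qed.

Lemma reducible_all v : reducible v.
Proof.
apply: reducible_terms => t _.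
have [[j [/= t_j [de [t_de mult_de]]]]|] := classic (@covered D t).
  by rewrite [t]surjective_pairing t_de t_j; apply: reducible_cone.
exact: reducible_uncovered.
Qed.

End Premarked.

Section Writings.
Variable D : marked_family n A.
Hypothesis hD : premarked D.
Local Notation H := (@mf_head _ _ D).
Local Notation F := (mf_mx D).
Local Notation d := (@mf_sh _ _ D).

Lemma writing_unique v P Q :
  is_writing H F v P -> is_writing H F v Q -> P = Q.
Proof.
move=> [vP conP] [vQ conQ]; apply/eqP; rewrite -subr_eq0; apply/eqP.
apply: (conical_normal_eq0 hD) => [j de|t _].
  rewrite /in_supp !mxE mcoeffB => nz.
  have [Q_de|Q_de] := eqVneq ((Q j 0)@_de) 0; last by apply/conQ/eqP.
  by apply: conP => P_de; apply: nz; rewrite P_de Q_de subr0.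
by rewrite mulmxBr -vP -vQ subrr mxE mcoeff0.
Qed.

Lemma hpart_conical d' s P : @conical D P -> @conical D (hpart d' s P).
Proof.
move=> conP j de; rewrite /in_supp mcoeff_hpart /= => nz.
by apply: conP => P_de; apply: nz; rewrite P_de mul0rn.
Qed.

Lemma hpart_normal d' s v : @normal D v -> @normal D (hpart d' s v).
Proof. by move=> norm_v t t_D; rewrite mcoeff_hpart norm_v // mul0rn. Qed.

(** The component of degree s of a writing is a writing of the component of
    degree s, so uniqueness applies. *)
Lemma writing_homog s v P : is_writing H F v P -> homog_of d s v ->
  homog_of (fun j => tdeg d (H j)) s P.
Proof.
move=> [vP conP] hv; rewrite (_ : P = hpart (fun j => tdeg d (H j)) s P).
  exact: hpart_homog.
apply: (writing_unique (v := v)) => //; split; last exact: hpart_conical.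
by rewrite -(hpart_mulmx (col_homog hD)) -vP hpart_id.
Qed.

Lemma writingP c : has_writings D ->
  is_writing H F (F *m c) (writing H F (F *m c)).
Proof. by move=> wD; apply: epsilon_spec; apply: wD. Qed.

Lemma has_writings_normal0 :
    (forall c, @normal D (F *m c) -> F *m c = 0) -> has_writings D.
Proof.
move=> normal0 c; have [P [h [conP norm_h eq_h]]] := reducible_all hD (F *m c).
have h_c : h = F *m (c - P) by rewrite mulmxBr eq_h addrC addKr.
exists P; split=> //.
by rewrite eq_h h_c (normal0 (c - P)) ?addr0 // -h_c.
Qed.

End Writings.

(** * The initial marked basis *)

Lemma marked_basis_premarked m N (d : 'I_m -> int) U (H : 'I_N -> mterm n m)
    (F : 'M[RA]_(m, N)) :
  marked_basis d U H F -> premarked (MarkedFamily d H F).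
Proof.
move=> [[[U_gen U_cones] marked] _].
have coef1 j : (F (H j).2 j)@_(H j).1 = 1 by have [] := marked j.
split=> /=.
- by move=> t; apply: (U_cones t).2.
- move=> t de /(U_cones t).1 /U_gen[r [s [c [s_H t_sum]]]].
  apply/(U_cones _).1/U_gen; exists r, s, (fun i => 'X_[de] * c i); split=> //.
  rewrite -scale_tvec t_sum scaler_sumr.
  by apply: eq_bigr => i _; rewrite scalerA.
- exact: coef1.
- move=> j t t_H ne_head; have [_ _ tail] := marked j.
  apply/eqP/negPn/negP => /eqP F_t; apply: (tail t); last exact/(U_cones t).1.
  rewrite /in_supp (@mcoeff_tail (MarkedFamily d H F)) -surjective_pairing.
  by case: eqP => // _; rewrite subr0.
- move=> j; have [[s hs] _ _] := marked j.
  suffices -> : tdeg d (H j) = s by [].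
  by apply: hs; rewrite /in_supp mxE coef1; apply/eqP/oner_neq0.
Qed.

(** The condition that (F) and the span of N(U) meet trivially is given degree by
    degree, so it is applied to the homogeneous components of a remainder. *)
Lemma marked_basis_has_writings m N (d : 'I_m -> int) U (H : 'I_N -> mterm n m)
    (F : 'M[RA]_(m, N)) :
  marked_basis d U H F -> has_writings (MarkedFamily d H F).
Proof.
move=> hF; have hD := marked_basis_premarked hF.
apply: (has_writings_normal0 hD) => /= c norm_c.
apply: (hpart_eq0 (d := d)) => s.
have [[[_ U_cones] _] /(_ s)[_ direct]] := hF.
apply: direct; last first.
- move=> t t_s; split; last exact: (hpart_homog t_s).
  move=> /(U_cones t).1 t_H; apply: t_s.
  exact: (hpart_normal (D := MarkedFamily d H F)).
- exact: hpart_homog.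
- by exists (hpart (fun j => tdeg d (H j)) s c); rewrite -(hpart_mulmx (col_homog hD)).
Qed.

(** * Fundamental syzygies form a marked family with writings *)

Section Syzygies.
Variable D : marked_family n A.
Hypotheses (hD : premarked D) (wD : has_writings D).
Local Notation H := (@mf_head _ _ D).
Local Notation F := (mf_mx D).
Local Notation d := (@mf_sh _ _ D).
Local Notation D' := (syz_family D).

Definition prolongation (p : 'I_(mf_size D) * 'I_n.+1) : 'cV[RA]_(mf_rk D) :=
  'X_(p.2) *: col p.1 F.

Lemma prolongation_writing p :
  is_writing H F (prolongation p) (writing H F (prolongation p)).
Proof. by rewrite /prolongation -mulmx_scale_delta; apply: writingP. Qed.

Lemma mcoeff_syz k q e :
  (mf_mx D' k q)@_e =
  ((e, k) == @mf_head _ _ D' q)%:R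
    - (writing H F (prolongation (enum_val q)) k 0)@_e.
Proof.
rewrite mxE /fund_syz mxE mcoeffD -mcoeff_tvec; congr (_ + _).
by rewrite mxE mcoeffN.
Qed.

Lemma mulmx_syz0 : F *m mf_mx D' = 0.
Proof.
have syz0 p : F *m fund_syz H F p = 0.
  rewrite /fund_syz mulmxBr mulmx_scale_delta.
  by have [<- _] := prolongation_writing p; rewrite subrr.
apply/matrixP => k q; rewrite -[RHS](_ : (F *m fund_syz H F (enum_val q)) k 0 = _).
  by rewrite mxE [RHS]mxE; apply: eq_bigr => j _; congr (_ * _); rewrite mxE.
by rewrite syz0 !mxE.
Qed.

(** The largest non-multiplicative variable x_i of j that divides a term of
    component j is its largest variable, so the term is in the cone of the head
    x_i e_j. *)
Lemma syz_coveredP (t : mterm n (mf_rk D')) :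
  @covered D' t <-> exists2 i, nonmult (H t.2).1 i & (0 < t.1 i)%N.
Proof.
split=> [[q [/= t_j [de [-> _]]]]|[i0 nm_i0 t_i0]].
  exists (enum_val q).2; last by rewrite mnmDE mnm1E eqxx addn1.
  by rewrite t_j; have := enum_valP q; rewrite inE.
have P0 : nonmult (H t.2).1 i0 && (0 < t.1 i0)%N by rewrite nm_i0.
have [i /andP[nm_i t_i] max_i] := @arg_maxnP _ i0
  (fun i => nonmult (H t.2).1 i && (0 < t.1 i)%N) (@nat_of_ord _) P0.
have p_nm : (t.2, i) \in nonmult_pairs D by rewrite inE.
exists (enum_rank_in p_nm (t.2, i)); rewrite /term_cone /= enum_rankK_in //=.
split=> //; exists (t.1 - U_(i))%MM; split.
  by rewrite submK //; apply/mnm_lepP => k; rewrite mnm1E; case: eqP => // <-.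
move=> k; rewrite nonmult_var => lt_ik; rewrite mnmBE mnm1E.
case: (posnP (t.1 k)) => [-> //|t_k].
have := max_i k; rewrite (nonmult_trans nm_i lt_ik) t_k => /(_ isT) le_ki.
by have := leq_trans lt_ik le_ki; rewrite ltnn.
Qed.

(** The duality that drives the iteration: involutive coefficient vectors for D
    are the normal vectors for its fundamental syzygies. *)
Lemma conical_syz_normal P : @conical D P <-> @normal D' P.
Proof.
split=> [conP t /syz_coveredP[i nm_i t_i]|normP j de P_de].
  apply/eqP/negPn/negP => /eqP P_t.
  have /in_cone_mul/(_ i nm_i) := conP t.2 t.1 P_t.
  by move=> t_i0; rewrite t_i0 in t_i.
apply/in_cone_mul => i nm_i; apply/eqP; rewrite -leqn0 leqNgt; apply/negP => de_i.
by apply: P_de; apply: (normP (de, j)); apply/syz_coveredP; exists i.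
Qed.

Lemma syz_premarked : premarked D'.
Proof.
have head_cov q := head_covered (D := D') q.
have writing_normal q := (conical_syz_normal _).1 (prolongation_writing q).2.
split.
- move=> t q q' [/= t_j [de [t_de mult_de]]] [/= t_j' [de' [t_de' mult_de']]].
  suffices : enum_val q = enum_val q' by apply: enum_val_inj.
  rewrite [LHS]surjective_pairing [RHS]surjective_pairing.
  rewrite -t_j -t_j'; congr (_, _).
  by apply: cone_var_inj mult_de mult_de' _; rewrite -t_de -t_de'.
- move=> t de /syz_coveredP[i nm_i t_i]; apply/syz_coveredP; exists i => //=.
  by rewrite mnmDE addn_gt0 t_i orbT.
- move=> q; rewrite mcoeff_syz -surjective_pairing eqxx.
  by rewrite writing_normal ?subr0.
- move=> q t t_D ne_head; rewrite mcoeff_syz -surjective_pairing.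
  by rewrite (negPf (introN eqP ne_head)) writing_normal // subr0.
- move=> q [e k]; rewrite /in_supp mxE mcoeff_syz /=.
  case: eqP => [-> _ //|_]; rewrite sub0r => W_e.
  set p := enum_val q in W_e *.
  have hom_p : homog_of d (tdeg d (H p.1) + 1) (prolongation p).
    move=> [a b]; rewrite /in_supp mxE => /eqP /mcoeffM_neq0[x [y [/= -> ]]].
    rewrite mcoeffX; case: (_ =P x) => [<- _|_]; last by rewrite eqxx.
    move=> /eqP F_y; have := col_homog hD (j := p.1) (t := (y, b)) F_y => <-.
    by rewrite /tdeg /= mdegD mdeg1 PoszD [1 + _]addrC addrAC.
  have := writing_homog hD (prolongation_writing p) hom_p (t := (e, k)).
  rewrite /tdeg /= mdeg1 => -> //; first by rewrite addrC.
  by move=> W0; apply: W_e; rewrite W0 oppr0.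
Qed.

(** A normal syzygy is an involutive writing of 0. *)
Lemma syz_has_writings : has_writings D'.
Proof.
apply: (has_writings_normal0 syz_premarked) => c norm_c.
apply: (conical_normal_eq0 hD); first exact/conical_syz_normal.
by move=> t _; rewrite mulmxA mulmx_syz0 mul0mx mxE mcoeff0.
Qed.

End Syzygies.

(** * Constant entries of the differentials *)

Lemma Uresolution_marked (D : marked_family n A) :
    premarked D -> has_writings D ->
  forall t, premarked (Uresolution D t) /\ has_writings (Uresolution D t).
Proof.
move=> hD wD; elim=> //= t [hDt wDt]; split; first exact: syz_premarked.
exact: syz_has_writings.
Qed.

(** A homogeneous entry with a constant term is a constant. *)
Lemma no_constant_coef0 (D : marked_family n A) : premarked D ->
  no_nonzero_constant (mf_mx D) -> forall k j, (mf_mx D k j)@_0 = 0.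
Proof.
move=> hD no_const k j; apply/eqP/negPn/negP => F_0.
have deg_supp e : (mf_mx D k j)@_e != 0 ->
    tdeg (@mf_sh _ _ D) (e, k) = tdeg (@mf_sh _ _ D) (mf_head j).
  by move=> /eqP F_e; apply: (col_homog hD); rewrite /in_supp mxE.
move/eqP: (F_0); apply; apply: (no_const k j); apply/mpolyP => e.
rewrite mcoeffC; have [->|ne_e] := eqVneq e 0%MM; first by rewrite mulr1.
rewrite mulr0; apply/eqP/negPn/negP => /deg_supp.
rewrite -(deg_supp _ F_0) /tdeg /= mdeg0 => /addIr[/eqP]; rewrite mdeg_eq0.
exact/negP.
Qed.

(** The entry in row l of a syzygy is, up to a term of positive degree, minus
    the coefficient P_l of the writing; its constant term is read off at the
    head x_a e_b of column l, where the prolonged column has no term since it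
    starts in degree two. *)
Lemma syz_no_constant (D : marked_family n A) (linear_heads : forall j,
    exists i, (@mf_head _ _ D j).1 = U_(i)%MM) :
    premarked D -> has_writings D ->
  no_nonzero_constant (mf_mx D) -> no_nonzero_constant (mf_mx (syz_family D)).
Proof.
move=> hD wD /(no_constant_coef0 hD) F_0 l q c S_c.
have -> : c = (mf_mx (syz_family D) l q)@_0 by rewrite S_c mcoeffC eqxx mulr1.
rewrite mcoeff_syz; set p := enum_val q; set P := writing _ _ _.
case: eqP => [/(congr1 fst)/= /(congr1 (@mdeg _))|_].
  by rewrite mdeg0 mdeg1.
have [a head_l] := linear_heads l; set b := (mf_head l).2.
have coef_a (f g : RA) : f@_0 = 0 -> (f * g)@_(U_(a)) = f@_(U_(a)) * g@_0.
  move=> f_0; apply: mcoeffM_single; first by rewrite addm0.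
  move=> x y xy f_x _; apply/eqP; rewrite -mdeg_eq0.
  have x_gt0 : (0 < mdeg x)%N.
    by rewrite lt0n mdeg_eq0; apply: contraNneq f_x => ->; rewrite f_0.
  by have := congr1 (@mdeg _) xy; rewrite mdegD mdeg1; lia.
have := congr1 (fun v : 'cV_(mf_rk D) => (v b 0)@_(U_(a)))
  (prolongation_writing wD p).1.
rewrite /= !mxE mulrC coef_a // mcoeffX [(_ == 0%MM)]negbTE; last first.
  by rewrite -mdeg_eq0 mdeg1.
rewrite mulr0 raddf_sum /= (bigD1 l) //= big1 => [|j ne_jl].
  rewrite coef_a // -head_l (head_coef hD) mul1r addr0 => <-.
  by rewrite subr0.
rewrite coef_a //; rewrite (tail_normal hD (t := (U_(a)%MM, b))) ?mul0r //.
  by rewrite -head_l -surjective_pairing; apply: head_covered.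
rewrite -head_l -surjective_pairing => head_eq; case/eqP: ne_jl.
apply: (cone_disjoint hD (t := mf_head l)); last by split; last exact: in_cone_refl.
by rewrite head_eq; split; last exact: in_cone_refl.
Qed.

End InvolutiveFamilies.

Theorem theorem3p7 (K : fieldType) (A : comAlgType K) (hA : noetherian A)
  (n m N : nat) (d : 'I_m -> int)
  (U : 'cV[{mpoly A[n.+1]}]_m -> Prop) (hU : quasi_stable U)
  (H : 'I_N -> mterm n m) (F : 'M[{mpoly A[n.+1]}]_(m, N))
  (hF : marked_basis d U H F)
  (M : 'cV[{mpoly A[n.+1]}]_m -> Prop) (hM : forall v, M v <-> span_cols F v)
  (t : nat) (ht : (0 < t)%N) :
  no_nonzero_constant (differential (MarkedFamily d H F) t) ->
  no_nonzero_constant (differential (MarkedFamily d H F) t.+1).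
Proof.
case: t ht => // t _.
have [hDt wDt] := Uresolution_marked (marked_basis_premarked hF)
  (marked_basis_has_writings hF) t.+1.
by apply: syz_no_constant => // q; exists (enum_val q).2.
Qed.
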